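(* Let $\mathcal X$ be a genus $2$ curve over $\mathbb{Q}$ given by an equation $y^2=f(x)$, where $f(x)=a_6x^6+a_5x^5+\cdots+a_0$ has integer coefficients, has degree $5$ or $6$, and has no repeated roots when regarded as a binary sextic. Let $\mathfrak p=[J_2(f):J_4(f):J_6(f):J_{10}(f)]\in \mathbb{WP}^3_{(2,4,6,10)}(\mathbb{Q})$ be the corresponding point, let $\mathfrak h(\mathfrak p)$ be its weighted moduli height, and let $H(\mathcal X)=H(f)=\max_{0\le i\le 6}|a_i|$ be the naive height. Then $$\mathfrak h(\mathfrak p)\;\le\; 2^3\sqrt{3\cdot 5\cdot 7}\;\cdot H(\mathcal X).$$
   Context: Weighted projective space: $\mathbb{WP}^3_{(2,4,6,10)}(\mathbb{Q})$ is the set of nonzero tuples $(x_0,x_1,x_2,x_3)\in\mathbb{Q}^4$ modulo the action $\lambda\star(x_0,x_1,x_2,x_3)=(\lambda^2x_0,\lambda^4x_1,\lambda^6x_2,\lambda^{10}x_3)$, $\lambda\in\mathbb{Q}^*$. Weighted gcd: for a nonzero integer tuple $(x_0,x_1,x_2,x_3)$ and weights $(q_0,q_1,q_2,q_3)=(2,4,6,10)$, the weighted greatest common divisor is the largest positive integer $d$ such that $d^{q_i}\mid x_i$ for all $i$. An integer tuple is normalized if its weighted gcd is $1$. Every point has a normalized integer representative, obtained from any integer representative by acting with $\lambda=1/d$, where $d$ is its weighted gcd. Weighted moduli height: for $\mathfrak p\in \mathbb{WP}^3_{(2,4,6,10)}(\mathbb{Q})$ with normalized integer representative $(J_2,J_4,J_6,J_{10})$,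 $$\mathfrak h(\mathfrak p)=\max\{|J_2|^{1/2},|J_4|^{1/4},|J_6|^{1/6},|J_{10}|^{1/10}\}.$$ Invariants: $J_2,J_4,J_6,J_{10}$ are the arithmetic invariants of binary sextics, homogeneous polynomials with integer coefficients of degrees $2,4,6,10$ in $a_0,\dots,a_6$. If $a_6\neq 0$ and $\alpha_1,\dots,\alpha_6$ are the roots of $f$, and $(ij)$ denotes $\alpha_i-\alpha_j$, then $$J_2=a_6^2\sum_{15}(12)^2(34)^2(56)^2,$$ $$J_4=a_6^4\sum_{10}(12)^2(23)^2(31)^2(45)^2(56)^2(64)^2,$$ $$J_6=a_6^6\sum_{60}(12)^2(23)^2(31)^2(45)^2(56)^2(64)^2(14)^2(25)^2(36)^2,$$ $$J_{10}=a_6^{10}\prod_{i<j}(ij)^2,$$ where each sum runs over the distinct expressions obtained by permuting the six roots (the subscript is the number of such expressions). For $a_6=0$ the invariants are obtained by evaluating the same polynomials in $a_0,\dots,a_6$. For example, $f=x^6-1$ gives $(J_2,J_4,J_6,J_{10})=(240,1620,119880,46656)$, and $f=x^5-x$ gives $(-40,-80,320,-256)$. *)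

(* Defs.v *)
From HB Require Import structures.
From mathcomp Require Import all_boot all_order all_fingroup all_algebra all_field.
From mathcomp Require Import boolp classical_sets reals exp.
From mathcomp Require Import generic_quotient mpoly.
From mathcomp Require Import zify ring.

Set Implicit Arguments.
Unset Strict Implicit.
Unset Printing Implicit Defensive.

Import Order.TTheory GRing.Theory Num.Theory.
Local Open Scope ring_scope.
Local Open Scope quotient_scope.

(******************************************************************************)
(* Invariants of binary sextics                                               *)
(*                                                                            *)
(* The variable 'X_i of {mpoly int[6]} is the root alpha_(i+1); the variable  *)
(* 'X_k of {mpoly int[7]} is the coefficient a_k.                             *)
(******************************************************************************)

Definition wt (i : 'I_4) : nat := tnth [tuple 2; 4; 6; 10]%N i.

(* The pair (i, j) in s, with 1 <= i, j <= 6, contributes the factor (ij)^2. *)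
Definition sqdiffs (s : seq (nat * nat)) : {mpoly int[6]} :=
  \prod_(e <- s) ('X_(inord e.1.-1) - 'X_(inord e.2.-1)) ^+ 2.

(* Sum of the distinct polynomials obtained from p by permuting the roots. *)
Definition orbit_sum (p : {mpoly int[6]}) : {mpoly int[6]} :=
  \sum_(r <- undup [seq msym s p | s : 'S_6]) r.

Definition two_triangles : seq (nat * nat) :=
  [:: (1, 2); (2, 3); (3, 1); (4, 5); (5, 6); (6, 4)]%N.

(* J_2, J_4, J_6, J_10 of a monic sextic, as functions of its roots. *)
Definition J_roots (i : 'I_4) : {mpoly int[6]} :=
  tnth [tuple orbit_sum (sqdiffs [:: (1, 2); (3, 4); (5, 6)]%N)
            ; orbit_sum (sqdiffs two_triangles)
            ; orbit_sum (sqdiffs (two_triangles ++ [:: (1, 4); (2, 5); (3, 6)]%N))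
            ; \prod_(i < 6) \prod_(j < 6 | (i < j)%N) ('X_i - 'X_j) ^+ 2 ] i.

(* For p symmetric of degree at most d in each root, the polynomial in        *)
(* a_0, ..., a_6 equal to a_6^d * p(roots). Write p = t(s_1, ..., s_6) with   *)
(* s_k the elementary symmetric polynomials (symf p is t, and its variable    *)
(* 'X_k stands for s_(k+1)), substitute s_k = (-1)^k a_(6-k) / a_6 and clear  *)
(* denominators: t has total degree at most d (symf_deg), so the subtraction  *)
(* d - mdeg m does not truncate. See homogenized_roots.                       *)
Definition homogenized (d : nat) (p : {mpoly int[6]}) : {mpoly int[7]} :=
  let t := symf p in
  \sum_(m <- msupp t) t@_m *:
    ('X_ord_max ^+ (d - mdeg m) *
     \prod_(k < 6) ((-1) ^+ k.+1 *: 'X_(inord (5 - k))) ^+ m k).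

(* J_2, J_4, J_6, J_10 as polynomials in the coefficients, characterised by   *)
(* J_inv_roots below.                                                         *)
Definition J_inv (i : 'I_4) : {mpoly int[7]} := homogenized (wt i) (J_roots i).

Definition invariants (f : {poly int}) : 'rV[int]_4 :=
  \row_i (J_inv i).@[fun k : 'I_7 => f`_k].

(* Multiplicity of a point of P^1 as a root of the binary sextic              *)
(* \sum_k a_k x^k z^(6-k); None is the point at infinity, whose multiplicity  *)
(* is 6 - deg f.                                                              *)
Definition sextic_mult (f : {poly int}) (P : option algC) : nat :=
  if P is Some a then mup a (map_poly intr f) else (7 - size f)%N.

Definition no_repeated_roots (f : {poly int}) : Prop :=
  forall P, (sextic_mult f P <= 1)%N.

Definition naive_height (f : {poly int}) : nat := \max_(i < 7) `|(f`_i)%R|%N.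

(******************************************************************************)
(* The weighted projective space WP^3_(2,4,6,10)(Q) and its height            *)
(******************************************************************************)

Definition wact (l : rat) (x : 'rV[rat]_4) : 'rV[rat]_4 :=
  \row_i (l ^+ wt i * x ord0 i).

Definition nztuple : Type := {x : 'rV[rat]_4 | x != 0}.
HB.instance Definition _ := Choice.on nztuple.

Definition wequiv (x y : nztuple) : bool :=
  `[< exists2 l : rat, l != 0 & val y = wact l (val x) >].

Lemma wact1 x : wact 1 x = x.
Proof. by apply/rowP=> i; rewrite mxE expr1n mul1r. Qed.

Lemma wactM l m x : wact l (wact m x) = wact (l * m) x.
Proof. by apply/rowP=> i; rewrite !mxE exprMn mulrA. Qed.

Lemma wequiv_refl : reflexive wequiv.
Proof. by move=> x; apply/asboolP; exists 1; rewrite ?oner_neq0 ?wact1. Qed.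

Lemma wequiv_sym : ssrbool.symmetric wequiv.
Proof.
have sub x y : wequiv x y -> wequiv y x.
  case/asboolP=> l nz_l e; apply/asboolP; exists l^-1; rewrite ?invr_eq0 //.
  by rewrite e wactM mulVf // wact1.
by move=> x y; apply/idP/idP; apply: sub.
Qed.

Lemma wequiv_trans : transitive wequiv.
Proof.
move=> y x z /asboolP[l nz_l ey] /asboolP[m nz_m ez]; apply/asboolP.
by exists (m * l); rewrite ?mulf_neq0 // -wactM -ey.
Qed.

Canonical wequiv_equiv := EquivRel wequiv wequiv_refl wequiv_sym wequiv_trans.

Definition WP3 : Type := {eq_quot wequiv_equiv}.

Definition wpoint (x : 'rV[rat]_4) (nz_x : x != 0) : WP3 :=
  \pi_{eq_quot wequiv_equiv} (exist _ x nz_x : nztuple).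

Definition wdvd (d : nat) (x : 'rV[int]_4) : Prop :=
  forall i, (d%:Z ^+ wt i %| x ord0 i)%Z.

Definition is_wgcd (x : 'rV[int]_4) (d : nat) : Prop :=
  [/\ (0 < d)%N, wdvd d x
    & forall e : nat, (0 < e)%N -> wdvd e x -> (e <= d)%N].

Definition normalized (x : 'rV[int]_4) : Prop := is_wgcd x 1.

Definition ratv (x : 'rV[int]_4) : 'rV[rat]_4 := map_mx intr x.

Definition normalized_rep (p : WP3) (x : 'rV[int]_4) : Prop :=
  normalized x /\ exists nz_x : ratv x != 0, p = wpoint nz_x.

(* Each point has exactly one normalized integer representative              *)
(* (normalized_rep_ex, normalized_rep_uniq), so xget picks it and its default *)
(* value 0 is never used.                                                     *)
Definition wheight (R : realType) (p : WP3) : R :=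
  let x := xget 0 [set x | normalized_rep p x] in
  \big[Num.max/0]_(i < 4) (`|(x ord0 i)%:~R| `^ (wt i)%:R^-1).

Lemma wpoint_eq x y (nx : x != 0) (ny : y != 0) :
  wpoint nx = wpoint ny <-> exists2 l : rat, l != 0 & y = wact l x.
Proof.
split=> [/eqP|h]; last by apply/eqP; rewrite eqmodE; apply/asboolP.
by rewrite eqmodE => /asboolP.
Qed.

Lemma wt_gt0 i : (0 < wt i)%N.
Proof. by case: i => [[|[|[|[|//]]]] ?]. Qed.

Lemma wt_even i : exists k, wt i = (2 * k)%N.
Proof. by case: i => [[|[|[|[|//]]]] ?]; [exists 1%N|exists 2%N|exists 3%N|exists 5%N]. Qed.

Lemma ratv_eq0 x : (ratv x == 0) = (x == 0).
Proof.
apply/eqP/eqP => [/rowP h|->]; last by apply/rowP => i; rewrite !mxE.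
by apply/rowP => i; have /eqP := h i; rewrite !mxE intr_eq0 => /eqP.
Qed.

Lemma wdvd_le d x : x != 0 -> wdvd d x -> (d <= \sum_i `|x ord0 i|)%N.
Proof.
move=> nzx h; have [i nzi] : exists i, x ord0 i != 0.
  apply/existsP; apply: contraNT nzx => /existsPn h'.
  by apply/eqP/rowP => i; have /negPn/eqP -> := h' i; rewrite mxE.
have := h i; rewrite dvdzE abszX /= => /dvdn_leq; rewrite absz_gt0 => /(_ nzi) dx.
rewrite (bigD1 i) //=; apply: leq_trans (leq_addr _ _).
apply: leq_trans dx; case: (d) => // d'; rewrite -[X in (X <= _)%N]expn1.
by apply: leq_pexp2l => //; apply: wt_gt0.
Qed.

Lemma wgcd_exists x : x != 0 -> exists d, is_wgcd x d.
Proof.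
move=> nzx.
have ex : exists d, (fun d => `[< (0 < d)%N /\ wdvd d x >]) d.
  by exists 1%N; apply/asboolP; split=> // i; rewrite expr1n dvd1z.
have ub d : (fun d => `[< (0 < d)%N /\ wdvd d x >]) d -> (d <= \sum_i `|x ord0 i|)%N.
  by move=> /asboolP[_]; apply: wdvd_le.
case: (ex_maxnP ex ub) => d /asboolP[d0 dx] dm; exists d; split=> // e e0 ex'.
by apply: dm; apply/asboolP.
Qed.

Lemma normalized_rep_ex p : exists x, normalized_rep p x.
Proof.
have [y [nzy ->]] : exists y : 'rV[rat]_4, exists ny : y != 0, p = wpoint ny.
  exists (val (repr p)), (valP (repr p)); rewrite /wpoint.
  by rewrite -[LHS]reprK; apply: congr1; apply: val_inj.
pose N : int := \prod_i denq (y ord0 i).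
have nzN : N != 0 by apply/prodf_neq0 => i _; apply: denq_neq0.
have intNy i : exists z : int, z%:~R = N%:~R ^+ wt i * y ord0 i.
  exists (N ^+ (wt i).-1 * (\prod_(j | j != i) denq (y ord0 j)) * numq (y ord0 i)).
  have NE : N = denq (y ord0 i) * \prod_(j | j != i) denq (y ord0 j) by rewrite /N (bigD1 i).
  rewrite -[wt i in RHS](prednK (wt_gt0 i)) exprSr -mulrA !rmorphM rmorphXn /= -mulrA.
  congr (_ * _); rewrite NE rmorphM /=.
  by rewrite numqE [RHS]mulrC [in RHS]mulrA mulrC mulrA; congr (_ * _).
have {intNy} [z zE] := fin_all_exists intNy.
pose x : 'rV[int]_4 := \row_i z i.
have xE : ratv x = wact N%:~R y by apply/rowP => i; rewrite !mxE zE.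
have nzNr : (N%:~R : rat) != 0 by rewrite intr_eq0.
have nzx : x != 0.
  rewrite -ratv_eq0 xE; apply: contraNneq nzy => /(congr1 (wact N%:~R^-1)).
  rewrite wactM mulVf // wact1 => ->; apply/eqP/rowP => i.
  by rewrite !mxE mulr0.
have [d [d0 dx dm]] := wgcd_exists nzx.
have nzd : (d%:Z) != 0 by case: (d) d0.
pose w : 'rV[int]_4 := \row_i (x ord0 i %/ d%:Z ^+ wt i)%Z.
have wE i : w ord0 i * d%:Z ^+ wt i = x ord0 i by rewrite mxE divzK // dx.
have xw : ratv x = wact d%:~R (ratv w).
  by apply/rowP => i; rewrite mxE -wE rmorphM rmorphXn /= mulrC [RHS]mxE; congr (_ * _); rewrite [RHS]mxE.
have nzw : ratv w != 0.
  rewrite -ratv_eq0 xw in nzx; apply: contraNneq nzx => ->.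
  by apply/eqP/rowP => i; rewrite !mxE mulr0.
exists w; split; last first.
  exists nzw; apply/wpoint_eq; exists (N%:~R / d%:~R).
    by rewrite mulf_neq0 // invr_eq0 intr_eq0.
  by rewrite mulrC -wactM -xE xw wactM mulVf ?intr_eq0 // wact1.
split=> // [i|e e0 ew]; first by rewrite expr1n dvd1z.
have := dm (e * d)%N; rewrite muln_gt0 e0 d0 => /(_ isT).
have ed : wdvd (e * d)%N x.
  by move=> i; rewrite PoszM exprMn -wE dvdz_mul // ew.
by move/(_ ed); rewrite -[X in (_ <= X)%N]mul1n leq_pmul2r.
Qed.

Lemma wact_normalized l x y : l != 0 -> normalized x ->
  ratv y = wact l (ratv x) -> (`|denq l| = 1)%N.
Proof.
move=> nl [_ _ hx] e.
have : (`|denq l| <= 1)%N.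
  apply: hx => [|i]; first by rewrite absz_gt0 denq_neq0.
  have cop : coprimez (`|denq l|%N%:Z ^+ wt i) (numq l ^+ wt i).
    by rewrite coprimezXl // coprimezXr // coprimez_sym coprimezE coprime_num_den.
  rewrite -(Gauss_dvdzr _ cop).
  have /rowP/(_ i) := e; rewrite !mxE.
  rewrite -{1}(divq_num_den l) expr_div_n => h.
  have nd : ((denq l)%:~R : rat) != 0 by rewrite intr_eq0 denq_neq0.
  have : (y ord0 i * denq l ^+ wt i)%:~R = (numq l ^+ wt i * x ord0 i)%:~R :> rat.
    by rewrite !rmorphM !rmorphXn /= h mulrAC divfK // expf_neq0.
  move/intr_inj => <-; rewrite gez0_abs ?denq_ge0 //; exact: dvdz_mull.
by have := denq_neq0 l; rewrite -absz_gt0; case: (`|denq l|)%N => [|[|]].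
Qed.

Lemma normalized_rep_uniq p x y : normalized_rep p x -> normalized_rep p y -> x = y.
Proof.
move=> [nx [nzx ->]] [ny [nzy /wpoint_eq[l nl e]]].
have d1 := wact_normalized nl nx e.
have e' : ratv x = wact l^-1 (ratv y) by rewrite e wactM mulVf // wact1.
have n1 : (`|denq l^-1| = 1)%N by apply: (wact_normalized _ ny e'); rewrite invr_eq0.
have int_of q : (`|denq q| = 1)%N -> q = (numq q)%:~R.
  by move=> h; rewrite -{1}(divq_num_den q) -(gez0_abs (denq_ge0 q)) h divr1.
have m1 : numq l * numq l^-1 = 1.
  by apply: (@intr_inj rat); rewrite rmorphM /= -(int_of l) // -(int_of l^-1) // mulfV.
have l2 : l ^+ 2 = 1.
  have u : `|numq l|%N = 1%N.
    have := congr1 absz m1; rewrite abszM => /eqP; rewrite muln_eq1 => /andP[/eqP //].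
  by rewrite (int_of l d1); move: u; case: (numq l) => [[|[|]]|[|]].
have yx : ratv y = ratv x.
  apply/rowP => i; rewrite e mxE; have [k ->] := wt_even i.
  by rewrite exprM l2 expr1n mul1r.
apply/rowP => i; have /rowP/(_ i) := yx; rewrite !mxE => /intr_inj ->.
by [].
Qed.

(******************************************************************************)
(* The invariants in terms of the roots                                       *)
(******************************************************************************)

(* Each monomial of p has degree at most e in the i-th variable. *)
Definition degv (i : 'I_6) (e : nat) (p : {mpoly int[6]}) : Prop :=
  forall m, m \in msupp p -> (m i <= e)%N.

Lemma degvW i a b p : (a <= b)%N -> degv i a p -> degv i b p.
Proof. by move=> ab h m /h; lia. Qed.

Lemma degvD i e p q : degv i e p -> degv i e q -> degv i e (p + q).
Proof. by move=> hp hq m /msuppD_le; rewrite mem_cat => /orP[/hp|/hq]. Qed.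

Lemma degvB i e p q : degv i e p -> degv i e q -> degv i e (p - q).
Proof. by move=> hp hq m /msuppB_le; rewrite mem_cat => /orP[/hp|/hq]. Qed.

Lemma degvZ i e c p : degv i e p -> degv i e (c *: p).
Proof. by move=> hp m /msuppZ_le /hp. Qed.

Lemma degv0 i e : degv i e 0.
Proof. by move=> m; rewrite msupp0. Qed.

Lemma degv1 i e : degv i e 1.
Proof. by move=> m; rewrite msupp1 inE => /eqP->; rewrite mnm0E. Qed.

Lemma degvM i a b p q : degv i a p -> degv i b q -> degv i (a + b) (p * q).
Proof.
move=> hp hq m /msuppM_le /allpairsP[[m1 m2] /= [/hp h1 /hq h2 ->]].
by rewrite mnmDE leq_add.
Qed.

Lemma degvXn i a p n : degv i a p -> degv i (a * n) (p ^+ n).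
Proof.
move=> hp; elim: n => [|n IHn]; first exact: degv1.
by rewrite exprS mulnS; apply: degvM.
Qed.

Lemma degv_sum (I : eqType) i e (r : seq I) (P : pred I) F :
  (forall x, x \in r -> P x -> degv i e (F x)) -> degv i e (\sum_(x <- r | P x) F x).
Proof.
move=> h; rewrite big_seq_cond.
by elim/big_rec: _ => [|x q /andP[xr Px] IH]; [apply: degv0|apply: degvD => //; apply: h].
Qed.

Lemma degv_prod (I : Type) i (e : I -> nat) (r : seq I) (P : pred I) F :
  (forall x, P x -> degv i (e x) (F x)) ->
  degv i (\sum_(x <- r | P x) e x) (\prod_(x <- r | P x) F x).
Proof.
move=> h; elim/big_rec2: _ => [|x a q Px IH]; first exact: degv1.
by apply: degvM => //; apply: h.
Qed.

Lemma degvX i j : degv i (i == j) 'X_j.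
Proof. by move=> m; rewrite msuppX inE => /eqP->; rewrite mnm1E eq_sym. Qed.

Arguments degvX : clear implicits.
Arguments degvW {i a b p} _ _.
Lemma degv_mesym i k : degv i 1 (mesym 6 int k).
Proof.
by move=> m; rewrite msupp_mesymP => /existsP[h /andP[_ /eqP->]]; rewrite mnmE; case: (_ \in _).
Qed.

Local Notation S := [tuple mesym 6 int i.+1 | i < 6].

Lemma symf1_deg d p : p \is symmetric -> degv ord0 d p ->
  (msize (symf1 p).1 <= d.+1)%N /\ degv ord0 d (symf1 p).2.
Proof.
move=> sp hp; rewrite /symf1; case: (eqVneq p 0) => [_|nzp] /=.
  by rewrite msize0; split=> //; apply: degv0.
have srt := mlead_msym_sorted sp.
set m := mlead p; set F := [multinom _ | _ < _].
have mdF : (mdeg F <= d)%N.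
  have: (m ord0 <= d)%N by apply: hp; apply: mlead_supp.
  suff ->: mdeg F = m ord0 by [].
  have E (i : 'I_6) : m i = nth 0%N m i by rewrite (mnm_nth 0%N).
  have srt' i : (i < 5)%N -> (nth 0%N m i.+1 <= nth 0%N m i)%N.
    move=> i5; have i6 : (i < 6)%N by lia.
    have i6' : (i.+1 < 6)%N by lia.
    have := srt (Ordinal i6) (Ordinal i6') (leqnSn _).
    by rewrite -/m !E.
  rewrite mdegE (eq_bigr (fun i : 'I_6 => nth 0%N m i - nth 0%N m i.+1)%N); last first.
    by move=> i _; rewrite mnmE.
  have z6 : nth 0%N m 6 = 0%N by rewrite nth_default // size_tuple.
  have := srt' 0%N isT; have := srt' 1%N isT; have := srt' 2%N isT.
  have := srt' 3%N isT; have := srt' 4%N isT.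
  rewrite E !big_ord_recl big_ord0 /= z6 /bump /= ?add1n; move: (nth _ _ 0%N) (nth _ _ 1%N) (nth _ _ 2%N) (nth _ _ 3%N) (nth _ _ 4%N) (nth _ _ 5%N) => *. lia.
split; first by apply: leq_trans (mmeasureZ_le _ _ _) _; rewrite msizeX.
apply: degvB => //; apply: degvZ; rewrite comp_mpolyX.
apply: (degvW (a := \sum_(i < 6) 1 * F i)%N).
  by rewrite (eq_bigr F) -?mdegE // => i _; rewrite mul1n.
apply: degv_prod => i _; apply: degvXn; rewrite tnth_map; exact: degv_mesym.
Qed.

Lemma symf_deg d p : p \is symmetric -> degv ord0 d p -> (msize (symf p) <= d.+1)%N.
Proof.
rewrite /symf; move: (tag _) => k.
elim: k p => [|k IH] p sp hp /=; first by case: (symf1_deg sp hp).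
case E: (symf1 p) => [t1 q] /=; case E': (symfn k q) => [t2 r] /=.
have [h1 h2] := symf1_deg sp hp; rewrite E /= in h1 h2.
have /and3P[_ sq _] := symf1P sp; rewrite E /= in sq.
have := IH _ sq h2; rewrite E' /= => h3.
by apply: leq_trans (mmeasureD_le _ _ _) _; rewrite geq_max h1.
Qed.

Lemma homogenized_roots (K : idomainType) d p (c : K) (a : 6.-tuple K) :
  p \is symmetric -> degv ord0 d p ->
  let f := c *: \prod_(x <- a) ('X - x%:P) in
  mmap intr (fun k : 'I_7 => f`_k) (homogenized d p) = c ^+ d * mmap intr (tnth a) p.
Proof.
move=> sp hp f; rewrite {2}(symfP sp) comp_mpolyE /homogenized.
rewrite !raddf_sum mulr_sumr /= !big_seq; apply: eq_bigr => m ms.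
rewrite !mmapZ mulrCA; congr (_ * _).
have md : (mdeg m <= d)%N.
  by have := msize_mdeg_lt ms; have := symf_deg sp hp; lia.
rewrite rmorphM rmorphXn !rmorph_prod /= mmapX mmap1U.
have -> : f`_(ord_max : 'I_7) = c.
  rewrite /f coefZ; have := mroots_coeff a ord0; rewrite subn0 /= => ->.
  by rewrite expr0 mul1r mesym0E rmorph1 mulr1.
rewrite -[in RHS](subnK md) exprD -mulrA; congr (_ * _).
rewrite mdegE -prodrXr -big_split /=; apply: eq_bigr => k _.
rewrite !rmorphXn /= -exprMn tnth_map tnth_ord_tuple; congr (_ ^+ _).
rewrite mmapZ mmapX mmap1U inordK; last by lia.
have k7 : (k.+1 < 7)%N by rewrite ltnS.
rewrite /f coefZ; have := mroots_coeff a (Ordinal k7); rewrite /= subSS => ->.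
rewrite (rmorphXn intr) rmorphN1 mulrCA signrMK; congr (_ * _).
rewrite /mesym !raddf_sum /=; apply: eq_bigr => s _.
by rewrite !rmorph_prod /=; apply: eq_bigr => j _; rewrite mevalXU mmapX mmap1U.
Qed.

Lemma degv_msym (s : 'S_6) i e p : degv (s i) e p -> degv i e (msym s^-1 p).
Proof.
move=> hp m; rewrite mcoeff_msupp mcoeff_sym -mcoeff_msupp => /hp.
by rewrite mnmE permK.
Qed.

Lemma orbit_sum_sym p : orbit_sum p \is symmetric.
Proof.
apply/issymP => s; rewrite /orbit_sum raddf_sum /=.
rewrite -(big_map (msym s) xpredT id); apply: perm_big.
have inj := @inj_msym 6 int s.
apply: uniq_perm; rewrite ?undup_uniq ?(map_inj_uniq inj) ?undup_uniq //.
have im t : msym t p \in [seq msym u p | u : 'S_6] by apply: codom_f.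
move=> q; apply/mapP/idP => [[r]|].
  by rewrite mem_undup => /fintype.imageP[t _ ->] ->; rewrite mem_undup -msymMm im.
rewrite mem_undup => /fintype.imageP[t _ ->]; exists (msym (t * s^-1)%g p).
  by rewrite mem_undup im.
by rewrite -msymMm mulgKV.
Qed.

Lemma degv_orbit_sum e p : (forall i, degv i e p) -> forall i, degv i e (orbit_sum p).
Proof.
move=> hp i; apply: degv_sum => q; rewrite mem_undup => /fintype.imageP[t _ ->] _.
by rewrite -[t]invgK; apply: degv_msym.
Qed.

Lemma degv_sqdiffs s i :
  degv i (\sum_(e <- s) ((i == inord e.1.-1) + (i == inord e.2.-1)) * 2)%N (sqdiffs s).
Proof.
apply: degv_prod => e _; apply: degvXn; apply: degvB.
  by apply: (degvW _ (degvX _ _)); apply: leq_addr.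
by apply: (degvW _ (degvX _ _)); apply: leq_addl.
Qed.


Arguments degv_sqdiffs : clear implicits.
Lemma J_roots_deg k i : degv i (wt k) (J_roots k).
Proof.
have eqi (l : 'I_6) j : (j < 6)%N -> (l == inord j) = (val l == j).
  by move=> j6; rewrite -(inj_eq val_inj) /= inordK.
case: k => [[|[|[|[|//]]]] k4]; rewrite /J_roots /wt !(tnth_nth 0) ?(tnth_nth 0%N) /=.
- apply: degv_orbit_sum => {}i; apply: (degvW _ (degv_sqdiffs _ _)).
  by rewrite unlock /= !eqi //; case: i => [[|[|[|[|[|[|]]]]]]].
- apply: degv_orbit_sum => {}i; apply: (degvW _ (degv_sqdiffs _ _)).
  by rewrite unlock /= !eqi //; case: i => [[|[|[|[|[|[|]]]]]]].
- apply: degv_orbit_sum => {}i; apply: (degvW _ (degv_sqdiffs _ _)).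
  by rewrite unlock /= !eqi //; case: i => [[|[|[|[|[|[|]]]]]]].
apply: (degvW (a := \sum_(a < 6) \sum_(b < 6 | (a < b)%N) ((i == a) + (i == b)) * 2)%N).
  under eq_bigr do rewrite big_mkcond /=.
  rewrite !big_ord_recl !big_ord0 /= /bump /=; case: i => [[|[|[|[|[|[|i]]]]]] li] //=.
apply: degv_prod => a _; apply: degv_prod => b _; apply: degvXn; apply: degvB.
  by apply: (degvW _ (degvX _ _)); apply: leq_addr.
by apply: (degvW _ (degvX _ _)); apply: leq_addl.
Qed.

Lemma J_roots_sym k : J_roots k \is symmetric.
Proof.
case: k => [[|[|[|[|//]]]] k4]; rewrite /J_roots (tnth_nth 0) /=; try exact: orbit_sum_sym.
set P := \prod_(_ < _) _.
pose Q : {mpoly int[6]} := \prod_(x : 'I_6 * 'I_6 | x.1 != x.2) ('X_x.1 - 'X_x.2).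
have PQ : P = - Q.
  rewrite /P /Q pair_big_dep /=; symmetry.
  rewrite (bigID (fun x : 'I_6 * 'I_6 => (x.1 < x.2)%N)) /=.
  have swap_bij : {on [pred x : 'I_6 * 'I_6 | (x.1 != x.2) && ~~ (x.1 < x.2)%N], bijective (fun x : 'I_6 * 'I_6 => (x.2, x.1))}.
    by exists (fun x => (x.2, x.1)) => -[].
  rewrite [X in - (_ * X)](reindex _ swap_bij) /=.
  rewrite [X in - (X * _)](eq_bigl (fun x : 'I_6 * 'I_6 => (x.1 < x.2)%N)); last first.
    by move=> x /=; rewrite andb_idl // => h; rewrite neq_ltn h.
  rewrite [X in - (_ * X)](eq_bigl (fun x : 'I_6 * 'I_6 => (x.1 < x.2)%N)); last first.
    by move=> x /=; rewrite -leqNgt [RHS]ltn_neqAle -(inj_eq val_inj) eq_sym.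
  rewrite -big_split /=.
  rewrite [RHS](eq_bigr (fun x : 'I_6 * 'I_6 => - (('X_x.1 - 'X_x.2) * ('X_x.2 - 'X_x.1)))); last first.
    by move=> x _; rewrite -mulrN opprB expr2.
  rewrite prodrN.
  have -> : #|fun x : 'I_6 * 'I_6 => (x.1 < x.2)%N| = 15%N.
    rewrite -sum1_card -(pair_big_dep xpredT (fun i j : 'I_6 => (i < j)%N) (fun _ _ => 1%N)) /=.
    under eq_bigr do rewrite big_mkcond /=.
    by rewrite !big_ord_recl !big_ord0 /=.
  by rewrite -signr_odd expr1 mulN1r.
rewrite PQ rpredN; apply/issymP => s; rewrite rmorph_prod /=.
rewrite [RHS](reindex_inj (h := fun x : 'I_6 * 'I_6 => (s x.1, s x.2))) /=; last first.
  by move=> [a b] [c d] /= [/perm_inj -> /perm_inj ->].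
apply: eq_big => x; first by rewrite (inj_eq perm_inj).
by rewrite rmorphB /= /msym !mmapX !mmap1U.
Qed.

Lemma mmap_rmorph n (K L : comNzRingType) (g : {rmorphism K -> L}) v (p : {mpoly int[n]}) :
  g (mmap intr v p) = mmap intr (g \o v) p.
Proof.
rewrite /mmap rmorph_sum /=; apply: eq_bigr => m _.
rewrite rmorphM rmorph_int rmorph_prod /=; congr (_ * _).
by apply: eq_bigr => i _; rewrite rmorphXn.
Qed.

Lemma invariantsE (K : comNzRingType) f i :
  (invariants f ord0 i)%:~R = mmap intr (fun k : 'I_7 => (map_poly intr f : {poly K})`_k) (J_inv i).
Proof.
rewrite mxE /meval -[mmap _ _ _]/(mmap idfun _ _).
rewrite {1}/mmap rmorph_sum /=; apply: eq_bigr => m _.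
rewrite rmorphM rmorph_prod /=; congr (_ * _).
by apply: eq_bigr => k _; rewrite rmorphXn /= coef_map.
Qed.

Lemma poly_eq_off0 (K : numFieldType) (p q : {poly K}) :
  (forall e, e != 0 -> p.[e] = q.[e]) -> p = q.
Proof.
move=> h; apply/eqP; rewrite -subr_eq0; apply/eqP.
pose rs : seq K := [seq k.+1%:R | k <- iota 0 (size (p - q))].
apply: (@roots_geq_poly_eq0 _ _ rs); last by rewrite size_map size_iota.
  apply/allP => _ /mapP[k _ ->]; rewrite rootE !hornerE h ?subrr //.
  by rewrite pnatr_eq0.
by rewrite map_inj_uniq ?iota_uniq // => a b /eqP; rewrite eqr_nat => /eqP[].
Qed.

Lemma J_inv_roots (K : idomainType) i (c : K) (a : 6.-tuple K) :
  let f := c *: \prod_(x <- a) ('X - x%:P) in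
  mmap intr (fun k : 'I_7 => f`_k) (J_inv i) =
  c ^+ wt i * mmap intr (tnth a) (J_roots i).
Proof. by move=> f; apply: homogenized_roots; [apply: J_roots_sym | apply: J_roots_deg]. Qed.

Lemma mmap_J10 (K : comNzRingType) (a : 6.-tuple K) :
  mmap intr (tnth a) (J_roots ord_max) =
  \prod_(i < 6) \prod_(j < 6 | (i < j)%N) (tnth a i - tnth a j) ^+ 2.
Proof.
rewrite /J_roots (tnth_nth 0) /= rmorph_prod /=; apply: eq_bigr => i _.
rewrite rmorph_prod /=; apply: eq_bigr => j _.
by rewrite rmorphXn rmorphB /= !mmapX !mmap1U.
Qed.

Lemma J10_roots (K : idomainType) (c : K) (a : 6.-tuple K) :
  let f := c *: \prod_(x <- a) ('X - x%:P) in
  mmap intr (fun k : 'I_7 => f`_k) (J_inv ord_max) =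
  c ^+ 10 * \prod_(i < 6) \prod_(j < 6 | (i < j)%N) (tnth a i - tnth a j) ^+ 2.
Proof.
by move=> f; rewrite -mmap_J10; apply: J_inv_roots.
Qed.

Lemma prod_split5 (K : comNzRingType) (r : 5.-tuple K) (x : K) :
  \prod_(i < 6) \prod_(j < 6 | (i < j)%N)
     (tnth [tuple of rcons r x] i - tnth [tuple of rcons r x] j) ^+ 2 =
  (\prod_(i < 5) \prod_(j < 5 | (i < j)%N) (tnth r i - tnth r j) ^+ 2)
   * \prod_(i < 5) (tnth r i - x) ^+ 2.
Proof.
have lst : tnth [tuple of rcons r x] ord_max = x.
  by rewrite (tnth_nth x) /= nth_rcons size_tuple ltnn eqxx.
have fst (i : 'I_5) : tnth [tuple of rcons r x] (widen_ord (leqnSn 5) i) = tnth r i.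
  by rewrite !(tnth_nth x) /= nth_rcons size_tuple ltn_ord.
rewrite big_ord_recr /= [X in _ * X]big1 ?mulr1; last by move=> j; have := ltn_ord j; lia.
rewrite -big_split /=; apply: eq_bigr => i _.
by rewrite big_mkcond big_ord_recr /= ltn_ord lst fst -big_mkcond; congr (_ * _); apply: eq_bigr => j _; rewrite fst.
Qed.

Lemma prod_diff_neq0 (K : idomainType) n (r : n.-tuple K) : uniq r ->
  \prod_(i < n) \prod_(j < n | (i < j)%N) (tnth r i - tnth r j) ^+ 2 != 0.
Proof.
move=> ur; apply/prodf_neq0 => i _; apply/prodf_neq0 => j ij.
rewrite expf_neq0 // subr_eq0; apply/negP => /eqP /(tuple_uniqP _ ur) e.
by move: ij; rewrite e ltnn.
Qed.

Lemma J10_quintic (c : algC) (r : 5.-tuple algC) :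
  let f := c *: \prod_(x <- r) ('X - x%:P) in
  mmap intr (fun k : 'I_7 => f`_k) (J_inv ord_max) =
  c ^+ 10 * \prod_(i < 5) \prod_(j < 5 | (i < j)%N) (tnth r i - tnth r j) ^+ 2.
Proof.
move=> f.
set D := \prod_(i < 5) _.
pose v (k : 'I_7) : {poly algC} := (f`_k)%:P - (f * 'X)`_k *: 'X.
pose W := mmap intr v (J_inv ord_max).
have WE e : W.[e] = mmap intr (fun k : 'I_7 => (f * (1 - e *: 'X))`_k) (J_inv ord_max).
  rewrite -[W.[e]]/(horner_eval e W) mmap_rmorph; congr (mmap _ _ _).
  apply: funext => k /=; rewrite /horner_eval /v.
 rewrite hornerD hornerN hornerZ hornerX hornerC.
  by rewrite mulrBr mulr1 coefB -scalerAr; congr (_ - _); rewrite coefZ [RHS]mulrC.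
have -> : mmap intr (fun k : 'I_7 => f`_k) (J_inv ord_max) = W.[0].
  by rewrite WE scale0r subr0 mulr1.
have -> : W = (c ^+ 10 * D)%:P * \prod_(i < 5) (tnth r i *: 'X - 1) ^+ 2.
  apply: poly_eq_off0 => e nze.
  have fe : f * (1 - e *: 'X) = (- (c * e)) *: \prod_(x <- [tuple of rcons r e^-1]) ('X - x%:P).
    rewrite /= -cats1 big_cat big_seq1 /= /f -scalerAl scaleNr -scalerN -scalerA; congr (_ *: _).
    rewrite -mulrN scalerAr opprB scalerBr -[e *: _%:P]mul_polyC -polyCM mulfV //.
  rewrite WE fe J10_roots prod_split5 hornerM hornerC -/D.
  rewrite horner_prod exprNn -signr_odd expr0 mul1r exprMn.
  rewrite mulrACA; congr (_ * _).
  have -> : e ^+ 10 = \prod_(i < 5) e ^+ 2.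

    by rewrite prodr_const card_ord -exprM.
  rewrite -big_split /=; apply: eq_bigr => i _; rewrite -exprMn horner_exp; congr (_ ^+ 2).
  by rewrite mulrBr mulfV // hornerD hornerN hornerZ hornerX hornerC [_ * e]mulrC.
rewrite hornerM hornerC horner_prod big1 ?mulr1 // => i _.
by rewrite !hornerE; ring.
Qed.

Lemma invariants_neq0 (f : {poly int}) : size f = 6%N \/ size f = 7%N -> no_repeated_roots f ->
  ratv (invariants f) != 0.
Proof.
move=> sf hf; suff: invariants f ord0 ord_max != 0.
  by apply: contraNneq => /rowP/(_ ord_max)/eqP; rewrite mxE [X in _ == X]mxE intr_eq0.
rewrite -(intr_eq0 algC) invariantsE.
set F := map_poly _ f.
have sF : size F = size f by rewrite size_map_inj_poly // => // x y; apply: intr_inj.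
have [r rE] := closed_field_poly_normal F.
have nzF : F != 0 by rewrite -size_poly_eq0 sF; case: sf => ->.
have nzc : lead_coef F != 0 by rewrite lead_coef_eq0.
have sr : size F = (size r).+1.
  by rewrite rE size_scale // size_prod_XsubC.
have ur : uniq r.
  apply: count_mem_uniq => x; rewrite -has_pred1 has_count.
  suff: (count_mem x r <= 1)%N by case: (count_mem x r) => [|[|]].
  have := hf (Some x); rewrite /= -/F rE -mul_polyC mupMr ?mu_prod_XsubC //.
  by rewrite rootC.
rewrite sF in sr; rewrite rE.
case: sf => sf; rewrite sf in sr; move/eqP: sr; rewrite eq_sym eqSS => sr.
  rewrite (J10_quintic _ (Tuple sr)) mulf_neq0 ?expf_neq0 //.
  exact: (prod_diff_neq0 (r := Tuple sr)).
rewrite (J10_roots _ (Tuple sr)) mulf_neq0 ?expf_neq0 //.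
exact: (prod_diff_neq0 (r := Tuple sr)).
Qed.

Definition moduli_point (f : {poly int})
    (deg_f : size f = 6%N \/ size f = 7%N) (sep_f : no_repeated_roots f) : WP3 :=
  wpoint (invariants_neq0 deg_f sep_f).

(* Main.v *)
(* If alpha_1, ..., alpha_6 are the roots of f, then
   |alpha_i - alpha_j| <= 2 max(1,|alpha_i|) max(1,|alpha_j|). In each term of
   J_(2k) every root occurs with degree 2k, so the term is at most
   64^k M(f)^(2k) with M(f) = |a_6| prod max(1,|alpha_i|) the Mahler measure,
   and there are at most 15^k terms. Landau's inequality
   M(f)^2 <= sum |a_i|^2 <= 7 H^2 gives |J_(2k)| <= (15 * 64 * 7 * H^2)^k, and
   15 * 64 * 7 = (2^3 sqrt(3 * 5 * 7))^2. The degree 5 case follows by letting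
   e -> 0 in f + e X^6. The normalized representative is obtained from the
   invariants by dividing out powers of an integer. *)
Require Import Defs.
From mathcomp Require Import all_boot all_order all_fingroup all_algebra all_field.
From mathcomp Require Import boolp classical_sets reals exp.
From mathcomp Require Import mpoly.
From mathcomp Require Import zify ring.
Set Implicit Arguments.
Unset Strict Implicit.
Unset Printing Implicit Defensive.

Import Order.TTheory GRing.Theory Num.Theory.
Local Open Scope ring_scope.

(** * Mahler measure and Landau's inequality *)

Section Mahler.
Variable C : numClosedFieldType.
Implicit Types (p q : {poly C}) (a : C).

Definition max1 (a : C) : C := Num.max 1 `|a|.
Definition sqnorm (p : {poly C}) : C := \sum_(i < size p) `|p`_i| ^+ 2.

Lemma sqnormE n p : (size p <= n)%N -> sqnorm p = \sum_(i < n) `|p`_i| ^+ 2.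
Proof.
move=> le_pn; rewrite /sqnorm (big_ord_widen n (fun i => `|p`_i| ^+ 2)) // big_mkcond /=.
apply: eq_bigr => i _; case: ltnP => // le_pi.
by rewrite nth_default // normr0 expr0n.
Qed.

Lemma comparable1_norm a : (1 >=< `|a|)%O.
Proof. by apply: real_comparable; rewrite ?real1 ?normr_real. Qed.

Lemma max1_ge1 a : 1 <= max1 a.
Proof. by rewrite /max1 comparable_le_max ?lexx ?comparable1_norm. Qed.

Lemma max1_ge_norm a : `|a| <= max1 a.
Proof. by rewrite /max1 comparable_le_max ?lexx ?orbT ?comparable1_norm. Qed.

Lemma max1_ge0 a : 0 <= max1 a.
Proof. exact: le_trans (max1_ge1 a). Qed.

Lemma sqnorm_ge0 p : 0 <= sqnorm p.
Proof. by apply: sumr_ge0 => i _; rewrite exprn_ge0. Qed.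

(** ['X - a%:P] and its reflection [a^* *: 'X - 1] have equal modulus on the unit circle, so
    multiplying by either gives the same square norm. The proof is algebraic: the coefficientwise
    differences telescope. *)
Lemma sqnorm_reflect q a : sqnorm (('X - a%:P) * q) = sqnorm ((a^* *: 'X - 1) * q).
Proof.
have s1 : (size (('X - a%:P) * q)%R <= (size q).+1)%N.
  by apply: leq_trans (size_polyMleq _ _) _; rewrite size_XsubC.
have s2 : (size ((a^* *: 'X - 1) * q)%R <= (size q).+1)%N.
  apply: leq_trans (size_polyMleq _ _) _.
  have : (size (a^* *: 'X - 1 : {poly C})%R <= 2)%N.
    apply: leq_trans (size_polyD _ _) _; rewrite size_polyN geq_max size_poly1 andbT.
    by apply: leq_trans (size_scale_leq _ _) _; rewrite size_polyX.
  by move=> le2; rewrite -[X in (_ <= X)%N]/(2 + size q).-1 -!subn1 leq_sub2r // leq_add2r.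
rewrite (sqnormE s1) (sqnormE s2); apply/eqP; rewrite -subr_eq0 -sumrB; apply/eqP.
(* The [i]-th difference is [(|a|^2 - 1)(|q_i|^2 - |q_(i-1)|^2)]. The value 0 at index 0 stands for
   [q_(-1)], and the last term vanishes beyond the size of [q]. *)
pose u i := (`|a| ^+ 2 - 1) * (if i is j.+1 then `|q`_j| ^+ 2 else 0).
rewrite (eq_bigr (fun i : 'I_(size q).+1 => u i.+1 - u i)) => [|[i _] _ /=].
  rewrite -(big_mkord xpredT (fun i => u i.+1 - u i)) telescope_sumr // /u /=.
  by rewrite nth_default // normr0 expr0n /= !mulr0 subrr.
rewrite !mulrBl mul1r -scalerAl !coefB coefZ coefXM coefCM /u.
case: i => [|i] /=; rewrite ?sub0r ?mulr0 ?sub0r ?subr0 ?normrN ?normrM.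
  by rewrite exprMn mulrBl mul1r.
by rewrite !normCK !rmorphB !rmorphM /= !conjCK; ring.
Qed.

(** The cofactor [q] makes the induction work: a root of modulus at most 1 moves into [q] unchanged,
    while a larger root moves in reflected, so that [lead_coef q] absorbs the factor [max1 a]. *)
Lemma landau_mul (s : seq C) q :
  `|lead_coef q| ^+ 2 * \prod_(x <- s) max1 x ^+ 2
    <= sqnorm (q * \prod_(x <- s) ('X - x%:P)).
Proof.
elim: s q => [|a s IHs] q.
  rewrite !big_nil !mulr1; have [->|nzq] := eqVneq q 0.
    by rewrite lead_coef0 normr0 expr0n sqnorm_ge0.
  rewrite /sqnorm lead_coefE; move: nzq; rewrite -size_poly_gt0; case: (size q) => // n _.
  by rewrite big_ord_recr /= lerDr sumr_ge0 // => i _; rewrite exprn_ge0.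
rewrite !big_cons; have [le_a1|lt_1a] := real_leP (normr_real a) (real1 C).
  have := IHs (q * ('X - a%:P)).
  rewrite lead_coef_Mmonic ?monicXsubC // -mulrA.
  by rewrite /max1 comparable_maxEge ?comparable1_norm // le_a1 expr1n mul1r.
have nza : a^* != 0 by rewrite conjC_eq0 -normr_gt0 (lt_trans ltr01).
have := IHs ((a^* *: 'X - 1) * q).
rewrite lead_coefM lead_coefDl; last by rewrite size_polyN size_poly1 size_scale // size_polyX.
rewrite lead_coefZ lead_coefX mulr1 normrM norm_conjC exprMn -[_ * q * _]mulrA -sqnorm_reflect.
rewrite /max1 comparable_maxEge ?comparable1_norm // (lt_geF lt_1a).
by rewrite -mulrA mulrCA [X in sqnorm X]mulrCA.
Qed.

Lemma landau (c : C) (s : seq C) :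
  `|c| ^+ 2 * \prod_(x <- s) max1 x ^+ 2 <= sqnorm (c *: \prod_(x <- s) ('X - x%:P)).
Proof. by rewrite -{1}[c]lead_coefC -mul_polyC landau_mul. Qed.

End Mahler.

(** * Polynomial inequalities in the limit at zero *)

(** An explicit Lipschitz bound at 0, valid on [0 < e <= 1], replaces continuity. *)
Lemma norm_horner0_le (K : numFieldType) (p q : {poly K}) : 0 <= q.[0] ->
  (forall e, 0 < e -> `|p.[e]| <= q.[e]) -> `|p.[0]| <= q.[0].
Proof.
have lip (r : {poly K}) :
    exists2 M, 0 <= M & forall e, 0 < e <= 1 -> `|r.[e] - r.[0]| <= e * M.
  elim/poly_ind: r => [|r c _]; first by exists 0 => // e _; rewrite !horner0 subrr normr0 mulr0.
  (* For [r * 'X + c%:P] the difference quotient at [e] is [r.[e]], and the powers of [e] are at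
     most 1. *)
  exists (\sum_(i < size r) `|r`_i|); first exact: sumr_ge0.
  move=> e /andP[e0 e1]; rewrite !hornerE addrK normrM (gtr0_norm e0) mulrC ler_pM2l //.
  rewrite horner_coef; apply: le_trans (ler_norm_sum _ _ _) _; apply: ler_sum => i _.
  by rewrite normrM normrX (gtr0_norm e0) ler_piMr // exprn_ile1 // ltW.
have [M M0 dp] := lip p; have [N N0 dq] := lip q => q0_ge0 le_pq.
apply/ler_addgt0Pr => d d0; have D0 : 0 < d + (M + N) by rewrite ltr_wpDr // addr_ge0.
(* This choice gives both [e <= 1] and [e * (M + N) <= d]. *)
pose e := d / (d + (M + N)); have e0 : 0 < e by rewrite divr_gt0.
have e01 : 0 < e <= 1 by rewrite e0 ler_pdivrMr // mul1r lerDl addr_ge0.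
have le_ed : e * M + e * N <= d.
  by rewrite -mulrDr mulrAC ler_pdivrMr // ler_pM2l // lerDr ltW.
have qe_ge0 : 0 <= q.[e] by apply: le_trans (le_pq _ e0).
have le_q : q.[e] <= q.[0] + e * N.
  rewrite -lerBlDl; apply: le_trans (dq _ e01); apply: real_ler_norm.
  by rewrite rpredB // ger0_real.
have le_p : `|p.[0]| <= `|p.[e]| + e * M.
  rewrite -lerBlDl; apply: le_trans (dp _ e01).
  by rewrite distrC; apply: lerB_dist.
apply: le_trans le_p _; apply: (@le_trans _ _ (q.[0] + (e * M + e * N))); last by rewrite lerD2l.
by rewrite [e * M + _]addrC addrA lerD2r (le_trans (le_pq _ e0)).
Qed.

(** * Number of terms in the orbit sums *)

(* An orbit of edge lists up to orientation and order: unlike the orbit of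
   polynomials it can be computed, and it is at least as large. *)
Section OrbitSize.
Local Open Scope nat_scope.

Definition relabel (t : seq nat) (e : nat * nat) : nat * nat :=
  (nth 0 t e.1.-1, nth 0 t e.2.-1).

Definition edge_le (e f : nat * nat) : bool :=
  (e.1 < f.1) || (e.1 == f.1) && (e.2 <= f.2).

Definition norm_edges (L : seq (nat * nat)) : seq (nat * nat) :=
  sort edge_le [seq (minn e.1 e.2, maxn e.1 e.2) | e <- L].

Definition orbit_edges (L : seq (nat * nat)) : seq (seq (nat * nat)) :=
  undup [seq norm_edges (map (relabel t) L) | t <- permutations (iota 1 6)].

Definition in_range (L : seq (nat * nat)) : bool :=
  all (fun e => [&& 0 < e.1 <= 6 & 0 < e.2 <= 6]) L.

Lemma sqdiffs_norm L : sqdiffs (norm_edges L) = sqdiffs L.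
Proof.
rewrite /sqdiffs (perm_big _ (permEl (perm_sort _ _))) /= big_map.
apply: eq_bigr => -[i j] _ /=; rewrite /minn /maxn; case: ltnP => // _.
by rewrite -sqrrN opprB.
Qed.

Definition perm_labels (s : 'S_6) : seq nat := [seq (val (s i)).+1 | i <- enum 'I_6].

Lemma perm_labels_perm s : perm_labels s \in permutations (iota 1 6).
Proof.
rewrite mem_permutations; apply: uniq_perm; rewrite ?iota_uniq //.
  rewrite map_inj_uniq ?enum_uniq // => i j [] /val_inj; exact: perm_inj.
move=> k; rewrite mem_iota; apply/mapP/idP => [[i _ ->]|k16]; first by rewrite /= ltnS.
have k6 : k.-1 < 6 by lia.
exists ((s^-1)%g (Ordinal k6)); first by rewrite mem_enum.
by rewrite permKV /=; lia.
Qed.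

Lemma msym_sqdiffs (s : 'S_6) L :
  in_range L -> msym s (sqdiffs L) = sqdiffs (map (relabel (perm_labels s)) L).
Proof.
have lab k : 0 < k <= 6 -> inord (nth 0 (perm_labels s) k.-1).-1 = s (inord k.-1).
  move=> k16; have k6 : k.-1 < 6 by lia.
  rewrite (nth_map ord0) ?size_enum_ord //= inord_val; congr (s _).
  by apply: val_inj; rewrite /= nth_enum_ord // inordK.
move=> /allP rng; rewrite /sqdiffs rmorph_prod big_map /= !big_seq.
apply: eq_bigr => e /rng /andP[e1 e2].
by rewrite rmorphXn rmorphB /= /msym !mmapX !mmap1U !lab.
Qed.

(** Each polynomial of the orbit is [sqdiffs] of a normalized relabelling of [L], so the image of
    [orbit_edges L] covers the orbit. *)
Lemma size_orbit_sqdiffs L : in_range L ->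
  size (undup [seq msym s (sqdiffs L) | s : 'S_6]) <= size (orbit_edges L).
Proof.
move=> rng; rewrite -(size_map sqdiffs); apply: uniq_leq_size; first exact: undup_uniq.
move=> p; rewrite mem_undup => /fintype.imageP[s _ ->].
rewrite msym_sqdiffs // -sqdiffs_norm map_f // mem_undup.
by apply: (map_f (fun t => norm_edges (map (relabel t) L))); apply: perm_labels_perm.
Qed.

(** These are the perfect matchings of the complete graph on six vertices. *)
Lemma size_orbit_matching : size (orbit_edges [:: (1, 2); (3, 4); (5, 6)]) = 15.
Proof. by vm_compute. Qed.

Lemma size_orbit_triangles : size (orbit_edges two_triangles) = 10.
Proof. by vm_compute. Qed.

(** The triangular prism has 12 automorphisms, and 720 / 12 = 60. *)
Lemma size_orbit_prism :
  size (orbit_edges (two_triangles ++ [:: (1, 4); (2, 5); (3, 6)])) = 60.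
Proof. by vm_compute. Qed.

End OrbitSize.

Lemma wt_double i : wt i = (2 * (wt i)./2)%N.
Proof. by have [k ->] := wt_even i; rewrite !mul2n doubleK. Qed.

(** * Bounds for the invariants over an algebraically closed field *)

Section RootBound.
Variable C : numClosedFieldType.
Implicit Types (v : 'I_6 -> C).

Lemma normB_max1 (x y : C) : `|(x - y) ^+ 2| <= 4 * (max1 x ^+ 2 * max1 y ^+ 2).
Proof.
have x0 := max1_ge0 x; have y0 := max1_ge0 y.
have -> : 4 * (max1 x ^+ 2 * max1 y ^+ 2) = (max1 x * max1 y + max1 x * max1 y) ^+ 2 by ring.
rewrite normrX lerXn2r ?nnegrE ?addr_ge0 ?mulr_ge0 //.
apply: le_trans (ler_normB _ _) _; apply: lerD.
  by apply: le_trans (max1_ge_norm _) _; rewrite ler_peMr ?max1_ge1.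
by apply: le_trans (max1_ge_norm _) _; rewrite ler_peMl ?max1_ge1.
Qed.

Lemma norm_sqdiffs_le v L :
  `|mmap intr v (sqdiffs L)|
    <= \prod_(e <- L) (4 * (max1 (v (inord e.1.-1)) ^+ 2 * max1 (v (inord e.2.-1)) ^+ 2)).
Proof.
rewrite rmorph_prod normr_prod; apply: ler_prod => e _; rewrite normr_ge0.
by rewrite rmorphXn rmorphB /= !mmapX !mmap1U normB_max1.
Qed.

Lemma mmap_msym v s p : mmap intr v (msym s p) = mmap intr (v \o s) p :> C.
Proof.
rewrite /msym [X in mmap intr v X]/mmap raddf_sum /=; apply: eq_bigr => m _.
rewrite rmorphM /= mmapC rmorph_prod; congr (_ * _); apply: eq_bigr => i _.
by rewrite rmorphXn /= mmapX mmap1U.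
Qed.

Lemma prod_ord6 (g : 'I_6 -> C) :
  \prod_i g i = g (inord 0) * g (inord 1) * g (inord 2) * g (inord 3) * g (inord 4) * g (inord 5).
Proof.
rewrite (eq_bigr (fun i : 'I_6 => g (inord i))) => [|i _]; last by rewrite inord_val.
by rewrite -(big_mkord xpredT (fun i => g (inord i))) unlock /= mulr1 !mulrA.
Qed.

(** The product identity says that [L] is [k]-regular on six vertices: it has [3k] edges, whence
    [4^(3k) = 64^k]. It is asked for every [b] because each permuted term uses its own
    [max1 \o v \o s]. Finally 15 * 64 = 960. *)
Lemma orbit_sqdiffs_le v L k (n := size (orbit_edges L)) : in_range L ->
  (forall b : 'I_6 -> C,
     \prod_(e <- L) (4 * (b (inord e.1.-1) ^+ 2 * b (inord e.2.-1) ^+ 2)) =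
     64 ^+ k * \prod_i (b i ^+ 2) ^+ k) ->
  (n <= 15 ^ k)%N ->
  `|mmap intr v (orbit_sum (sqdiffs L))| <= (960 * \prod_i max1 (v i) ^+ 2) ^+ k.
Proof.
move=> rng prodL le_n; rewrite /orbit_sum raddf_sum /=.
apply: le_trans (ler_norm_sum _ _ _) _.
set B := 64 ^+ k * \prod_i (max1 (v i) ^+ 2) ^+ k.
have B0 : 0 <= B.
  by rewrite mulr_ge0 ?exprn_ge0 ?prodr_ge0 // => i _; rewrite !exprn_ge0 ?max1_ge0.
have le_B p : p \in undup [seq msym s (sqdiffs L) | s : 'S_6] -> `|mmap intr v p| <= B.
  rewrite mem_undup => /fintype.imageP[s _ ->]; rewrite mmap_msym.
  apply: le_trans (norm_sqdiffs_le _ _) _; rewrite (prodL (fun i => max1 (v (s i)))).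
  by rewrite /B [X in _ <= _ * X](reindex_perm s).
rewrite big_seq; apply: le_trans (ler_sum _ le_B) _.
rewrite -big_seq big_const_seq count_predT iter_addr_0 -[B *+ _]mulr_natl.
apply: (@le_trans _ _ ((15 ^ k)%:R * B)).
 by rewrite ler_wpM2r // ler_nat (leq_trans (size_orbit_sqdiffs rng)).
by rewrite natrX /B prodrXl mulrA -!exprMn -natrM.
Qed.

Lemma J_roots_le i (a : 6.-tuple C) :
  `|mmap intr (tnth a) (J_roots i)| <= (960 * \prod_(x <- a) max1 x ^+ 2) ^+ (wt i)./2.
Proof.
rewrite big_tuple.
case: i => [[|[|[|[|//]]]] k4].
- rewrite /J_roots /wt !(tnth_nth 0) ?(tnth_nth 0%N) /=.
  apply: orbit_sqdiffs_le; rewrite ?size_orbit_matching //.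
  by move=> b; rewrite prod_ord6 unlock /=; ring.
- rewrite /J_roots /wt !(tnth_nth 0) ?(tnth_nth 0%N) /=.
  apply: orbit_sqdiffs_le; rewrite ?size_orbit_triangles //.
  by move=> b; rewrite prod_ord6 unlock /=; ring.
- rewrite /J_roots /wt !(tnth_nth 0) ?(tnth_nth 0%N) /=.
  apply: orbit_sqdiffs_le; rewrite ?size_orbit_prism //.
  by move=> b; rewrite prod_ord6 unlock /=; ring.
(* The discriminant is a single product over all 15 pairs, with each root in 5 of them:
   [4^15 = 64^5], and 64 is at most 960. *)
have -> : Ordinal k4 = ord_max by apply: val_inj.
rewrite mmap_J10 normr_prod.
pose m i := max1 (tnth a i) ^+ 2.
apply: (@le_trans _ _ (\prod_(i < 6) \prod_(j < 6 | (i < j)%N) (4 * (m i * m j)))).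
  apply: ler_prod => i _; rewrite normr_ge0 normr_prod; apply: ler_prod => j _.
  by rewrite normr_ge0 normB_max1.
have -> : \prod_(i < 6) \prod_(j < 6 | (i < j)%N) (4 * (m i * m j)) = (64 * \prod_i m i) ^+ 5.
  under [LHS]eq_bigr do rewrite big_mkcond /=.
  by rewrite !big_ord_recl !big_ord0 /=; ring.
rewrite lerXn2r ?nnegrE ?mulr_ge0 ?prodr_ge0 //; try by move=> i _; rewrite exprn_ge0 ?max1_ge0.
by rewrite ler_wpM2r ?ler_nat // prodr_ge0 // => i _; rewrite exprn_ge0 ?max1_ge0.
Qed.

Lemma J_inv_le_deg6 i (f : {poly C}) : size f = 7%N ->
  `|mmap intr (fun k : 'I_7 => f`_k) (J_inv i)| <= (960 * \sum_(k < 7) `|f`_k| ^+ 2) ^+ (wt i)./2.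
Proof.
move=> sf; have [r rE] := closed_field_poly_normal f.
have nzf : f != 0 by rewrite -size_poly_eq0 sf.
have nzc : lead_coef f != 0 by rewrite lead_coef_eq0.
have sr : size r == 6%N.
  by have /eqP := sf; rewrite rE size_scale // size_prod_XsubC.
rewrite -(sqnormE (n := 7)) ?sf //.
(* Naming the function lets [rE] act on its argument only, since the right-hand side of [rE] again
   contains [f] through [lead_coef f]. *)
pose at_coefs (g : {poly C}) := mmap intr (fun k : 'I_7 => g`_k) (J_inv i).
have /(congr1 (fun x => `|x|)) :=
  etrans (congr1 at_coefs rE) (J_inv_roots i (lead_coef f) (Tuple sr)).
rewrite /at_coefs => ->.
rewrite normrM normrX {1}wt_double exprM.
apply: (@le_trans _ _ ((`|lead_coef f| ^+ 2) ^+ (wt i)./2 *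
                       (960 * \prod_(x <- r) max1 x ^+ 2) ^+ (wt i)./2)).
  by rewrite ler_wpM2l ?exprn_ge0 //; apply: (J_roots_le i (Tuple sr)).
have P0 : 0 <= \prod_(x <- r) max1 x ^+ 2.
  by rewrite prodr_ge0 // => x _; rewrite exprn_ge0 ?max1_ge0.
rewrite -exprMn lerXn2r ?nnegrE ?mulr_ge0 ?ler0n ?exprn_ge0 ?sqnorm_ge0 //.
by rewrite mulrCA ler_wpM2l // [in X in _ <= X]rE landau.
Qed.

Lemma J_inv_le i (f : {poly C}) : (size f <= 7)%N ->
  `|mmap intr (fun k : 'I_7 => f`_k) (J_inv i)| <= (960 * \sum_(k < 7) `|f`_k| ^+ 2) ^+ (wt i)./2.
Proof.
rewrite leq_eqVlt => /predU1P[|sf]; first exact: J_inv_le_deg6.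
(* The coefficients of [f + e *: 'X^6] as polynomials in [e]; thus [W.[e]] is the invariant of the
   perturbed sextic and [Q.[e]] its bound. *)
pose v (k : 'I_7) : {poly C} := (f`_k)%:P + (k == ord_max)%:R *: 'X.
pose W := mmap intr v (J_inv i).
pose g e := f + e *: 'X^6.
have gE e (k : 'I_7) : (g e)`_k = f`_k + (k == ord_max)%:R * e.
  by rewrite /g coefD coefZ coefXn mulrC; congr (_ + _%:R * _); rewrite -(inj_eq val_inj).
have WE e : W.[e] = mmap intr (fun k : 'I_7 => (g e)`_k) (J_inv i).
  rewrite -[W.[e]]/(horner_eval e W) mmap_rmorph; congr (mmap _ _ _).
  by apply: funext => k /=; rewrite gE /horner_eval /v !hornerE.
pose Q : {poly C} := (960 *: ((\sum_(k < 7) `|f`_k| ^+ 2)%:P + 'X ^+ 2)) ^+ (wt i)./2.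
have QE e : Q.[e] = (960 * (\sum_(k < 7) `|f`_k| ^+ 2 + e ^+ 2)) ^+ (wt i)./2.
  by rewrite /Q horner_exp hornerZ hornerD hornerC hornerXn.
have := norm_horner0_le (p := W) (q := Q).
rewrite QE expr0n addr0 WE /g scale0r addr0; apply.
  by rewrite exprn_ge0 // mulr_ge0 ?ler0n // sumr_ge0 // => k _; rewrite exprn_ge0.
move=> e e0; have sg : size (g e) = 7%N.
  by rewrite /g addrC size_polyDl size_scale ?gt_eqF // size_polyXn.
rewrite WE QE; apply: le_trans (J_inv_le_deg6 i sg) _.
(* As [f] has no term of degree 6, the perturbation adds exactly [e ^+ 2] to the sum of squares. *)
have f6 : f`_(ord_max : 'I_7) = 0 by rewrite nth_default.
rewrite !(big_ord_recr 6) f6 normr0 [0 ^+ 2]expr0n [X in _ <= (_ * (X + _)) ^+ _]addr0.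
rewrite (gE e ord_max) f6 eqxx mul1r add0r gtr0_norm //.
by rewrite (eq_bigr (fun k : 'I_6 => `|f`_k| ^+ 2)) // => k _;
  rewrite (gE e (widen_ord (leqnSn 6) k)) -(inj_eq val_inj) /= ltn_eqF // mul0r addr0.
Qed.

End RootBound.

(** * Integer invariants, normalization and the height bound *)

Lemma invariants_le (f : {poly int}) i : (size f <= 7)%N ->
  (`|invariants f ord0 i| <= (6720 * naive_height f ^ 2) ^ (wt i)./2)%N.
Proof.
move=> sf; have sF : (size (map_poly intr f : {poly algC}) <= 7)%N.
  exact: leq_trans (size_poly _ _) sf.
rewrite -(ler_nat algC) natr_absz intr_norm invariantsE.
apply: le_trans (J_inv_le i sF) _; rewrite natrX natrM.
have S0 : 0 <= \sum_(k < 7) `|(map_poly intr f : {poly algC})`_k| ^+ 2.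
  by rewrite sumr_ge0 // => k _; rewrite exprn_ge0.
rewrite lerXn2r ?nnegrE ?mulr_ge0 ?ler0n //.
(* The factor 7 counts the coefficients, each of absolute value at most [naive_height f]. *)
have -> : 6720%N = (960 * 7)%N by vm_compute.
rewrite natrM -mulrA ler_wpM2l ?ler0n //.
have -> : 7%:R * (naive_height f ^ 2)%:R = \sum_(k < 7) (naive_height f ^ 2)%:R :> algC.
  by rewrite sumr_const card_ord mulr_natl.
apply: ler_sum => k _; rewrite coef_map /= -intr_norm natrX lerXn2r ?nnegrE ?ler0n //.
rewrite -natr_absz ler_nat.
exact: (leq_bigmax (F := fun k : 'I_7 => `|(f`_k)%R|%N) k).
Qed.

(** A scalar carrying a normalized tuple to an integer tuple has denominator 1, so it is a nonzero
    integer and cannot shrink any entry. *)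
Lemma wact_normalized_le (l : rat) (x y : 'rV[int]_4) i : l != 0 -> normalized x ->
  ratv y = wact l (ratv x) -> (`|x ord0 i| <= `|y ord0 i|)%N.
Proof.
move=> nzl nx e; have dl := wact_normalized nzl nx e.
have lE : l = (numq l)%:~R by rewrite -{1}(divq_num_den l) -(gez0_abs (denq_ge0 l)) dl divr1.
have /rowP/(_ i) := e; rewrite lE !mxE -rmorphXn -rmorphM => /intr_inj ->.
by rewrite abszM leq_pmull // abszX expn_gt0 absz_gt0 numq_eq0 nzl.
Qed.

Theorem lemma1 (R : realType) (f : {poly int})
  (deg_f : size f = 6%N \/ size f = 7%N) (sep_f : no_repeated_roots f) :
  wheight R (moduli_point deg_f sep_f)
    <= 2 ^+ 3 * Num.sqrt (3 * 5 * 7) * (naive_height f)%:R.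
Proof.
set H := naive_height f; rewrite /wheight.
have sf : (size f <= 7)%N by case: deg_f => ->.
have := xgetPex 0 (normalized_rep_ex (moduli_point deg_f sep_f)).
(* The symmetric form of the equality presents the invariants as [l] acting on the normalized
   [x]. *)
set x := xget _ _; move=> -[nx [nzx /esym/wpoint_eq[l nzl invE]]].
set B := _ * _; have B0 : 0 <= B by rewrite !mulr_ge0 ?exprn_ge0 ?sqrtr_ge0 ?ler0n.
(* [(2^3)^2 * 3 * 5 * 7 = 6720]; all weights are even, so only powers of [B ^+ 2] are compared. *)
have B2 : B ^+ 2 = (6720 * H ^ 2)%:R.
  rewrite /B !exprMn sqr_sqrtr ?mulr_ge0 ?ler0n // -!natrX -!natrM.
  by congr (_%:R); rewrite -[RHS]/(6720 * H ^ 2)%N.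
apply: bigmax_le => // i _.
have le_xB : `|(x ord0 i)%:~R| <= B ^+ wt i :> R.
  rewrite wt_double exprM B2 -natrX -intr_norm -natr_absz ler_nat.
  exact: leq_trans (wact_normalized_le i nzl nx invE) (invariants_le i sf).
have wt0 : (wt i)%:R != 0 :> R by rewrite pnatr_eq0 -lt0n wt_gt0.
(* With [B] written as a root of its own power, monotonicity of that root concludes. *)
have -> : B = (B ^+ wt i) `^ (wt i)%:R^-1.
  by rewrite -powR_mulrn // -powRrM mulfV // powRr1.
by apply: ge0_ler_powR; rewrite ?nnegrE ?invr_ge0 ?ler0n ?exprn_ge0.
Qed.
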